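(* There is an absolute constant $C>0$ such that for every $\epsilon>0$ and positive integer $m$, with $M=m^{C}\epsilon^{-C\epsilon^{-5}}$, the following holds: for every $n\in\mathbb{N}$ and every permutation $\sigma$ of $[n]$, there is an integer $k\in[m,M]$ such that every equitable partition of $[n]$ into $k$ intervals is $\epsilon$-regular for $\sigma$.
   Context: An interval is a subset of $[n]$ of consecutive integers. For an $n\times n$ matrix $Y=(y_{ij})$ and intervals $I,J$, $d_Y(I,J)=\frac{1}{|I||J|}\sum_{i\in I,j\in J}y_{ij}$. A pair $(I,J)$ is interval $\epsilon$-regular for $Y$ if for all subintervals $A\subseteq I$, $B\subseteq J$ with $|A|\ge\epsilon|I|$, $|B|\ge\epsilon|J|$, $|d_Y(A,B)-d_Y(I,J)|\le\epsilon$; a partition of $[n]$ into $k$ intervals is interval $\epsilon$-regular for $Y$ if all except at most $\epsilon k^2$ pairs of its intervals are interval $\epsilon$-regular. To a permutation $\sigma$ of $[n]$ associate the matrix $Y^\sigma$ with $y_{ij}=1$ if $\sigma(i)<j$ and $y_{ij}=0$ otherwise; a partition of $[n]$ into intervals is $\epsilon$-regular for $\sigma$ if it is interval $\epsilon$-regular for $Y^\sigma$. An equitable partition is one whose parts differ in size by at most one.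
   Formalization: The case m = 1 with ε > 1 is excluded: there M = ε^{-Cε^{-5}} < 1 for every C > 0, so [m, M] contains no integer and the claim as written fails. *)

(* Defs.v *)
From mathcomp Require Import all_boot all_order all_algebra all_fingroup.
From mathcomp Require Import reals exp.

Set Implicit Arguments.
Unset Strict Implicit.
Unset Printing Implicit Defensive.

Import Order.TTheory GRing.Theory Num.Theory.
Local Open Scope ring_scope.

(* [n] is 'I_n, i.e. {0, ..., n-1}: rows, columns and values of permutations
   are all shifted by one. The empty set counts as an interval, but it is never
   a part of a [partition], nor (for eps > 0) a subinterval tested in
   [interval_regular_pair]. *)
Definition is_intvl (n : nat) (A : {set 'I_n}) : bool :=
  [forall i in A, forall j in A, forall l : 'I_n, (i <= l <= j)%N ==> (l \in A)].

Section Regularity.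
Variables (R : realType) (n : nat).
Implicit Types (Y : 'M[R]_n) (eps : R) (I J A B : {set 'I_n}).
Implicit Type P : {set {set 'I_n}}.

Definition density Y I J : R :=
  (\sum_(i in I) \sum_(j in J) Y i j) / (#|I|%:R * #|J|%:R).

Definition interval_regular_pair eps Y I J : bool :=
  [forall A : {set 'I_n}, forall B : {set 'I_n},
    [&& is_intvl A, A \subset I, is_intvl B, B \subset J,
        eps * #|I|%:R <= #|A|%:R & eps * #|J|%:R <= #|B|%:R]
    ==> (`|density Y A B - density Y I J| <= eps)].

Definition interval_partition P : bool :=
  partition P [set: 'I_n] && [forall A in P, is_intvl A].

Definition equitable P : bool :=
  [forall A in P, forall B in P, (#|A| <= #|B|.+1)%N].

(* Pairs are ordered and include the diagonal ones (I, I): k ^ 2 in total. *)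
Definition interval_regular_partition eps Y P : bool :=
  #|[set IJ in setX P P | ~~ interval_regular_pair eps Y IJ.1 IJ.2]|%:R
    <= eps * (#|P|%:R ^+ 2).

Definition perm_matrix_lt (sigma : 'S_n) : 'M[R]_n :=
  \matrix_(i, j) ((sigma i < j)%N)%:R.

Definition perm_regular_partition eps (sigma : 'S_n) P : bool :=
  interval_regular_partition eps (perm_matrix_lt sigma) P.

End Regularity.

(* Main.v *)
Require Import Defs.
From mathcomp Require Import all_boot all_order all_algebra all_fingroup.
From mathcomp Require Import reals exp.
From mathcomp Require Import ring lra.

Set Implicit Arguments.
Unset Strict Implicit.
Unset Printing Implicit Defensive.

Import Order.TTheory GRing.Theory Num.Theory.
Local Open Scope ring_scope.

(** Let [err P] be the squared L2-distance from [Y] to the step function of its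
    averages on the cells of [P x P].  If an equitable [P] with [k] parts is
    irregular, add to this step function [+-eps] on a witness rectangle inside
    each irregular cell: the squared distance to [Y] drops by at least
    [eps ^ 5 n ^ 2 / 4].  Sampling the result at one point per part of an
    equitable interval partition [Q] with [k L] parts changes it only in cells
    cut by an endpoint of a witness or of a part of [P], at a cost
    [O(n ^ 2 / L)].  As the cell averages are the best step approximation,
    [err Q <= err P - eps ^ 5 n ^ 2 / 8] once [L >= 512 eps ^ -5], although [Q]
    need not refine [P].  Irregular equitable partitions therefore cannot exist
    for all the sizes [m L ^ i], [i <= T], when [T > 8 eps ^ -5]; a size for
    which no partition exists at all is fine as well. *)

(** * Least squares on a finite set *)

Section FiniteMeans.
Variables (R : realFieldType) (T : finType).
Implicit Types (S A : {set T}) (f : T -> R).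

Lemma sum_sqr_sub_mean_le S f c :
  \sum_(p in S) (f p - (\sum_(q in S) f q) / #|S|%:R) ^+ 2
    <= \sum_(p in S) (f p - c) ^+ 2.
Proof.
set d := _ / _.
have [->|S0] := eqVneq S set0; first by rewrite !big_set0.
have cS : (#|S|%:R : R) != 0 by rewrite pnatr_eq0 cards_eq0.
have sum_d : \sum_(p in S) (f p - d) = 0.
  by rewrite sumrB sumr_const -[d *+ _]mulr_natr /d mulfVK // subrr.
(* Expanding around the mean [d] leaves a cross term that is a multiple of [sum_d], hence zero. *)
have -> : \sum_(p in S) (f p - c) ^+ 2 =
   \sum_(p in S) (f p - d) ^+ 2 + (2 * (d - c)) * \sum_(p in S) (f p - d)
     + \sum_(p in S) (d - c) ^+ 2.
  by rewrite mulr_sumr -!big_split; apply: eq_bigr => p _ /=; ring.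
by rewrite sum_d mulr0 addr0 lerDl sumr_ge0 // => p _; apply: sqr_ge0.
Qed.

(** This measures the gain from correcting the constant [d] by [c] on [A] only: it is linear in the
    excess of [f] over [d] on [A], against a quadratic loss. *)
Lemma sum_sqr_sub_indicator S A f d c : A \subset S ->
  \sum_(p in S) (f p - (d + c * (p \in A)%:R)) ^+ 2 =
  \sum_(p in S) (f p - d) ^+ 2
    - 2 * c * (\sum_(p in A) f p - #|A|%:R * d) + c ^+ 2 * #|A|%:R.
Proof.
move=> /setIidPr sAS.
have sumA (F : T -> R) :
    \sum_(p in A) F p = \sum_(p in S) (p \in A)%:R * F p.
  rewrite -[in LHS]sAS; under eq_bigl => p do rewrite inE.
  rewrite big_mkcondr /=.
  by apply: eq_bigr => p _; case: (p \in A); rewrite ?mul1r ?mul0r.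
have -> : \sum_(p in A) f p - #|A|%:R * d = \sum_(p in A) (f p - d).
  by rewrite sumrB sumr_const mulr_natl.
have -> : (#|A|%:R : R) = \sum_(p in A) 1 by rewrite sumr_const.
rewrite !sumA !mulr_sumr -sumrB -big_split /=; apply: eq_bigr => p _.
by case: (p \in A) => /=; ring.
Qed.

End FiniteMeans.

(** * Interval partitions: blocks cut by an interval, sizes of equitable parts *)

Section Intervals.
Variable n : nat.
Implicit Types (A U : {set 'I_n}) (P : {set {set 'I_n}}).

Lemma is_intvlP A :
  reflect (forall i j l : 'I_n, i \in A -> j \in A -> (i <= l <= j)%N -> l \in A)
          (is_intvl A).
Proof.
apply: (iffP forall_inP) => [h i j l iA jA|h i iA].
  by move/forall_inP: (h i iA) => /(_ j jA) /forallP /(_ l) /implyP.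
by apply/forall_inP => j jA; apply/forallP => l; apply/implyP; apply: h iA jA.
Qed.

(** A set of points rather than of blocks. With [r] choosing a representative in each block, these
    are the points where sampling the indicator of [A] at representatives goes wrong. *)
Definition blocks_cut_by A (r : 'I_n -> 'I_n) : {set 'I_n} :=
  [set x | (x \in A) != (r x \in A)].

(* A block containing points inside and outside of [A] contains an endpoint
   of [A]. *)
Lemma card_blocks_cut_by P A (r : 'I_n -> 'I_n) (s : nat) :
    interval_partition P -> is_intvl A ->
    (forall x, r x \in pblock P x) -> (forall U, U \in P -> (#|U| <= s)%N) ->
  (#|blocks_cut_by A r| <= 2 * s)%N.
Proof.
move=> /andP[partP /forall_inP intP] /is_intvlP intA rP szP.
have cov x : x \in cover P by rewrite (cover_partition partP) inE.
have triv : trivIset P by case/and3P: partP.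
have [->|[x0 x0A]] := set_0Vmem A.
  by rewrite /blocks_cut_by; under eq_finset do rewrite !inE; rewrite cards0.
pose a := [arg min_(i < x0 in A) (i : nat)].
pose b := [arg max_(i > x0 in A) (i : nat)].
have [aA amin] : a \in A /\ forall x, x \in A -> (a <= x)%N.
  by rewrite /a; case: arg_minnP.
have [bA bmax] : b \in A /\ forall x, x \in A -> (x <= b)%N.
  by rewrite /b; case: arg_maxnP.
(* The point [z] lies left of [a] or right of [b], since everything between them is in [A]; that
   endpoint then sits between [z] and [y], so in the interval [U]. *)
have cut U y z : U \in P -> y \in U -> z \in U -> y \in A -> z \notin A ->
    (a \in U) || (b \in U).
  move=> UP yU zU yA zA; have /is_intvlP intU := intP _ UP.
  have [za|az] := ltnP z a.
    by rewrite (intU z y a) // (ltnW za) amin.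
  have [bz|zb] := ltnP b z.
    by rewrite (intU y z b) ?orbT // (ltnW bz) bmax.
  by rewrite (intA a b) ?az ?zb in zA.
suff sub : blocks_cut_by A r \subset pblock P a :|: pblock P b.
  apply: leq_trans (subset_leq_card sub) _.
  apply: leq_trans (leq_card_setU _ _) _.
  by rewrite mul2n -addnn leq_add // szP // pblock_mem.
apply/subsetP => x; rewrite !inE => xr.
have xU : x \in pblock P x by rewrite mem_pblock.
have UP : pblock P x \in P by rewrite pblock_mem.
have : (a \in pblock P x) || (b \in pblock P x).
  case xA: (x \in A) xr; case rA: (r x \in A) => //= _.
    by apply: (cut _ x (r x)); rewrite ?xA ?rA.
  by apply: (cut _ (r x) x); rewrite ?xA ?rA.
by case/orP=> /(same_pblock triv) ->; rewrite xU ?orbT.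
Qed.

(** Parts are nonempty, so the [+ 1] allowed by equitability is absorbed by a factor 2. *)
Lemma equitable_card_ge P U : interval_partition P -> equitable P ->
  U \in P -> (n <= 2 * #|P| * #|U|)%N.
Proof.
move=> /andP[partP _] /forall_inP eqP UP.
have Pn0 : set0 \notin P by case/and3P: partP.
rewrite -[leqLHS](card_ord n) -cardsT (card_partition partP).
have -> : (2 * #|P| * #|U| = \sum_(V in P) 2 * #|U|)%N.
  by rewrite sum_nat_const mulnCA mulnA.
apply: leq_sum => V VP; have /forall_inP /(_ U UP) h := eqP V VP.
apply: leq_trans h _; rewrite mul2n -addnn -addn1 leq_add2l card_gt0.
by apply: contraNneq Pn0 => <-.
Qed.

Lemma equitable_card_le P U : interval_partition P -> equitable P ->
  U \in P -> (#|P| * #|U| <= 2 * n)%N.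
Proof.
move=> /andP[partP _] /forall_inP eqP UP.
have Pn0 : set0 \notin P by case/and3P: partP.
rewrite -[X in (2 * X)%N](card_ord n) -cardsT (card_partition partP).
rewrite big_distrr /= -sum_nat_const.
apply: leq_sum => V VP; have /forall_inP /(_ V VP) h := eqP U UP.
apply: leq_trans h _; rewrite mul2n -addnn -addn1 leq_add2l card_gt0.
by apply: contraNneq Pn0 => <-.
Qed.

End Intervals.

(** * Squared error of step functions and its decrement *)

Section Energy.
Variables (R : realType) (n : nat).
Implicit Types (Y : 'M[R]_n) (eps : R) (I J A B : {set 'I_n}).
Implicit Type P : {set {set 'I_n}}.

Definition unit_valued Y := forall i j, 0 <= Y i j <= 1.

Lemma densityE Y I J : density Y I J =
  (\sum_(p in setX I J) Y p.1 p.2) / #|setX I J|%:R.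
Proof.
rewrite /density cardsX natrM pair_big; congr (_ / _).
by apply: eq_bigl => p; rewrite inE.
Qed.

Lemma sum_density Y I J :
  \sum_(p in setX I J) Y p.1 p.2 = #|setX I J|%:R * density Y I J.
Proof.
rewrite densityE; have [->|S0] := eqVneq (setX I J) set0.
  by rewrite big_set0 cards0 mul0r.
by rewrite mulrCA divff ?mulr1 // pnatr_eq0 cards_eq0.
Qed.

Lemma density_itv Y I J : unit_valued Y -> 0 <= density Y I J <= 1.
Proof.
move=> Y01; rewrite densityE; apply/andP; split.
  by rewrite divr_ge0 // sumr_ge0 // => p _; case/andP: (Y01 p.1 p.2).
have [->|S0] := eqVneq (setX I J) set0.
  by rewrite big_set0 mul0r ler01.
rewrite ler_pdivrMr ?ltr0n ?card_gt0 // mul1r -sumr_const.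
by apply: ler_sum => p _; case/andP: (Y01 p.1 p.2).
Qed.

Lemma sum_cells P (F : 'I_n * 'I_n -> R) : partition P [set: 'I_n] ->
  \sum_p F p = \sum_(I in P) \sum_(J in P) \sum_(p in setX I J) F p.
Proof.
move=> partP.
have part1 (G : 'I_n -> R) : \sum_x G x = \sum_(I in P) \sum_(x in I) G x.
  by rewrite -(set_partition_big _ partP) /=; apply: eq_bigl => x; rewrite inE.
transitivity (\sum_x \sum_y F (x, y)).
  by rewrite pair_bigA; apply: eq_bigr => -[].
rewrite part1; apply: eq_bigr => I _.
transitivity (\sum_(x in I) \sum_(J in P) \sum_(y in J) F (x, y)).
  by apply: eq_bigr => x _; apply: part1.
rewrite exchange_big; apply: eq_bigr => J _; rewrite pair_big.
by apply: eq_big => [p|[]//]; rewrite inE.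
Qed.

(** The quantity [err P] of the overview, not divided by [n ^ 2]. *)
Definition step_error Y P : R :=
  \sum_(p : 'I_n * 'I_n)
    (Y p.1 p.2 - density Y (pblock P p.1) (pblock P p.2)) ^+ 2.

Lemma step_error_cells Y P : partition P [set: 'I_n] ->
  step_error Y P = \sum_(I in P) \sum_(J in P)
    \sum_(p in setX I J) (Y p.1 p.2 - density Y I J) ^+ 2.
Proof.
move=> partP; have triv : trivIset P by case/and3P: partP.
rewrite /step_error (sum_cells _ partP).
apply: eq_bigr => I IP; apply: eq_bigr => J JP; apply: eq_bigr => p.
by rewrite inE => /andP[pI pJ]; rewrite !(def_pblock triv _ pI, def_pblock triv _ pJ).
Qed.

Lemma step_error_ge0 Y P : 0 <= step_error Y P.
Proof. by apply: sumr_ge0 => p _; apply: sqr_ge0. Qed.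

Lemma step_error_le Y P (g : {set 'I_n} -> {set 'I_n} -> R) :
    partition P [set: 'I_n] ->
  step_error Y P <=
    \sum_p (Y p.1 p.2 - g (pblock P p.1) (pblock P p.2)) ^+ 2.
Proof.
move=> partP; have triv : trivIset P by case/and3P: partP.
rewrite step_error_cells // (sum_cells _ partP).
apply: ler_sum => I IP; apply: ler_sum => J JP.
have -> : \sum_(p in setX I J) (Y p.1 p.2 - g (pblock P p.1) (pblock P p.2)) ^+ 2
   = \sum_(p in setX I J) (Y p.1 p.2 - g I J) ^+ 2.
  apply: eq_bigr => p; rewrite inE => /andP[pI pJ].
  by rewrite !(def_pblock triv _ pI, def_pblock triv _ pJ).
by rewrite densityE; apply: sum_sqr_sub_mean_le.
Qed.

Lemma step_error_le_sqr Y P : unit_valued Y -> partition P [set: 'I_n] ->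
  step_error Y P <= n%:R ^+ 2.
Proof.
move=> Y01 partP; apply: le_trans (step_error_le Y (fun _ _ => 0) partP) _.
have -> : (n%:R ^+ 2 : R) = \sum_(p : 'I_n * 'I_n) 1.
  by rewrite sumr_const card_prod card_ord natrM expr2.
apply: ler_sum => p _; have /andP[? ?] := Y01 p.1 p.2.
by rewrite subr0; nra.
Qed.

(* The correction [c] on the witness rectangle [A x B] is [eps] times the sign
   of the deviation of its density. *)
Lemma irregular_correction Y eps I J : 0 < eps <= 1 ->
  exists w : {set 'I_n} * {set 'I_n} * R,
    [/\ is_intvl w.1.1, is_intvl w.1.2, `|w.2| <= 1 &
      \sum_(p in setX I J)
          (Y p.1 p.2 - (density Y I J + w.2 * (p \in setX w.1.1 w.1.2)%:R)) ^+ 2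
      <= \sum_(p in setX I J) (Y p.1 p.2 - density Y I J) ^+ 2
         - (~~ interval_regular_pair eps Y I J)%:R
             * (eps ^+ 4 * (#|I|%:R * #|J|%:R))].
Proof.
move=> /andP[eps0 eps1].
have [reg|] := boolP (interval_regular_pair eps Y I J).
  (* A regular cell gets the empty rectangle and no correction, so that every pair has a witness. *)
  exists (set0, set0, 0); split=> /=; rewrite ?normr0 ?ler01 //.
  - by apply/is_intvlP => i j l; rewrite inE.
  - by apply/is_intvlP => i j l; rewrite inE.
  - rewrite mul0r subr0; apply: ler_sum => p _; by rewrite mul0r addr0.
rewrite /interval_regular_pair => /forallPn[A /forallPn[B]].
rewrite negb_imply -ltNge.
move=> /andP[/and5P[intA AI intB BJ /andP[cA cB]] dev].
set d := density Y I J in dev *.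
pose c : R := if d <= density Y A B then eps else - eps.
exists (A, B, c); split=> //=.
  by rewrite /c; case: ifP; rewrite ?normrN gtr0_norm.
rewrite mul1r (sum_sqr_sub_indicator (fun p => Y p.1 p.2)); last exact: setXS.
rewrite sum_density -mulrBr cardsX natrM.
have cdev : eps ^+ 2 <= c * (density Y A B - d).
  move: dev; rewrite /c; case: ifP => [h|/negbT].
    rewrite ger0_norm ?subr_ge0 // => h'.
    by rewrite expr2 ler_pM2l // ltW.
  rewrite -ltNge => h; rewrite ltr0_norm ?subr_lt0 // => h'.
  by rewrite mulNr -mulrN expr2 ler_pM2l // ltW.
have c2 : c ^+ 2 = eps ^+ 2 by rewrite /c; case: ifP; rewrite ?sqrrN.
have cAB : eps ^+ 2 * (#|I|%:R * #|J|%:R) <= #|A|%:R * #|B|%:R.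
  have -> : eps ^+ 2 * (#|I|%:R * #|J|%:R) = (eps * #|I|%:R) * (eps * #|J|%:R).
    by ring.
  by apply: ler_pM => //; apply: mulr_ge0 => //; apply: ltW.
rewrite c2; set N := #|A|%:R * #|B|%:R in cAB *.
have N0 : 0 <= N by apply: mulr_ge0.
(* The drop is [2 N c (d(A,B) - d) - eps ^ 2 N], which is at least [eps ^ 2 N] by [cdev], hence at
   least [eps ^ 4 |I| |J|] by [cAB]. *)
rewrite -!addrA lerD2l.
have h1 : N * eps ^+ 2 <= N * (c * (density Y A B - d)) by apply: ler_wpM2l.
have h2 : eps ^+ 2 * (eps ^+ 2 * (#|I|%:R * #|J|%:R)) <= eps ^+ 2 * N.
  by apply: ler_wpM2l => //; apply: sqr_ge0.
have -> : eps ^+ 4 * (#|I|%:R * #|J|%:R) = eps ^+ 2 * (eps ^+ 2 * (#|I|%:R * #|J|%:R)).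
  by ring.
have -> : 2 * c * (N * (density Y A B - d)) = 2 * (N * (c * (density Y A B - d))).
  by ring.
by lra.
Qed.

Lemma sum_setX_fst_le I J (S : {set 'I_n}) :
  \sum_(p in setX I J) (p.1 \in S)%:R <= #|J|%:R * #|S|%:R :> R.
Proof.
have -> : \sum_(p in setX I J) (p.1 \in S)%:R =
    \sum_(x in I) \sum_(y in J) (x \in S)%:R :> R.
  by rewrite pair_big; apply: eq_bigl => p; rewrite inE.
have -> : (#|S|%:R : R) = \sum_x (x \in S)%:R.
  by rewrite -sumr_const big_mkcond; apply: eq_bigr => x _; case: (x \in S).
rewrite mulr_sumr big_mkcond; apply: ler_sum => x _.
by case: (x \in I); rewrite ?mulr_ge0 // sumr_const mulr_natl.
Qed.

Lemma sum_setX_snd_le I J (S : {set 'I_n}) :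
  \sum_(p in setX I J) (p.2 \in S)%:R <= #|I|%:R * #|S|%:R :> R.
Proof.
have -> : \sum_(p in setX I J) (p.2 \in S)%:R =
    \sum_(p in setX J I) (p.1 \in S)%:R :> R.
  rewrite (reindex_inj (h := fun p => (p.2, p.1))) /=; last by move=> [? ?] [? ?] [-> ->].
  by apply: eq_bigl => p; rewrite !inE andbC.
exact: sum_setX_fst_le.
Qed.

(** With [k = #|P|], more than [eps k ^ 2] irregular cells, each with at least [(n / 2k) ^ 2]
    entries, gain [eps ^ 4] per entry: this gives [eps ^ 5 n ^ 2 / 4]. The last term is the cost of
    sampling on [Q]. *)
Lemma step_error_decrement Y eps P Q (s : nat) :
    unit_valued Y -> 0 < eps <= 1 -> (0 < n)%N ->
    interval_partition P -> interval_partition Q ->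
    (forall U, U \in P -> (n <= 2 * #|P| * #|U|)%N) ->
    (forall U, U \in Q -> (#|U| <= s)%N) ->
    ~~ interval_regular_partition eps Y P ->
  step_error Y Q <=
    step_error Y P - eps ^+ 5 / 4 * n%:R ^+ 2 + 32 * (s%:R * #|P|%:R * n%:R).
Proof.
move=> Y01 epsI n0 ipP ipQ szP szQ irr.
have [eps0 eps1] := andP epsI.
have [partP /forall_inP intP] := andP ipP; have [partQ _] := andP ipQ.
have trivP : trivIset P by case/and3P: partP.
have trivQ : trivIset Q by case/and3P: partQ.
have covQ x : x \in cover Q by rewrite (cover_partition partQ) inE.
have covP x : x \in cover P by rewrite (cover_partition partP) inE.
have [w wP] := fin_all_exists
  (fun IJ : {set 'I_n} * {set 'I_n} => irregular_correction Y IJ.1 IJ.2 epsI).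
(* The step function of [P], corrected on the witness rectangle of each cell. *)
pose g0 (p : 'I_n * 'I_n) : R :=
  let IJ := (pblock P p.1, pblock P p.2) in
  density Y IJ.1 IJ.2 + (w IJ).2 * (p \in setX (w IJ).1.1 (w IJ).1.2)%:R.
have g0_itv p : -1 <= g0 p <= 2.
  rewrite /g0 /=; set IJ := (_, _); have /andP[? ?] := density_itv IJ.1 IJ.2 Y01.
  have [_ _ + _] := wP IJ; rewrite ler_norml => /andP[? ?].
  by case: (_ \in _); rewrite ?mulr1 ?mulr0; lra.
(* The default value only serves the empty set, which is never a part. *)
pose rep (U : {set 'I_n}) := odflt (Ordinal n0) [pick y in U].
pose r x := rep (pblock Q x).
have rQ x : r x \in pblock Q x.
  rewrite /r /rep; case: pickP => //= /(_ x).
  by rewrite mem_pblock covQ.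
pose cut (A : {set 'I_n}) := blocks_cut_by A r.
have cut_le A : is_intvl A -> #|cut A|%:R <= 2 * s%:R :> R.
  by move=> intA; rewrite -natrM ler_nat (card_blocks_cut_by ipQ).
apply: le_trans (step_error_le Y (fun U V => g0 (rep U, rep V)) partQ) _.
rewrite (sum_cells _ partP) step_error_cells //.
pose irregIJ I J : R := (~~ interval_regular_pair eps Y I J)%:R.
(* The constant is [16 = 4 * 2 * 2]: a square is at most 4, each coordinate meets two intervals (a
   side of the cell and a side of the witness), and each interval spoils at most [2 s] points. *)
have cell I J : I \in P -> J \in P ->
  \sum_(p in setX I J) (Y p.1 p.2 - g0 (r p.1, r p.2)) ^+ 2 <=
  \sum_(p in setX I J) (Y p.1 p.2 - density Y I J) ^+ 2
   - irregIJ I J * (eps ^+ 4 * (#|I|%:R * #|J|%:R))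
   + 16 * s%:R * (#|I|%:R + #|J|%:R).
  move=> IP JP.
  have [intA intB _ wle] := wP (I, J); rewrite /= in wle.
  set A := (w (I, J)).1.1 in intA wle; set B := (w (I, J)).1.2 in intB wle.
  set c := (w (I, J)).2 in wle.
  pose b (S : {set 'I_n}) x : R := (x \in cut S)%:R.
  have pt p : p \in setX I J -> (Y p.1 p.2 - g0 (r p.1, r p.2)) ^+ 2 <=
      (Y p.1 p.2 - (density Y I J + c * (p \in setX A B)%:R)) ^+ 2
      + 4 * (b I p.1 + b A p.1 + (b J p.2 + b B p.2)).
    rewrite inE => /andP[pI pJ].
    have b0 S x : 0 <= b S x by rewrite ler0n.
    have := b0 I p.1; have := b0 A p.1; have := b0 J p.2; have := b0 B p.2.
    have [|good] := boolP [|| p.1 \in cut I, p.1 \in cut A, p.2 \in cut J | p.2 \in cut B].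
      move=> bad ? ? ? ?.
      have : 1 <= b I p.1 + b A p.1 + (b J p.2 + b B p.2).
        have b1 S x : x \in cut S -> b S x = 1 by rewrite /b => ->.
        by case/or4P: bad => /b1; lra.
      have := sqr_ge0 (Y p.1 p.2 - (density Y I J + c * (p \in setX A B)%:R)).
      have /andP[? ?] := g0_itv (r p.1, r p.2); have /andP[? ?] := Y01 p.1 p.2.
      have : (Y p.1 p.2 - g0 (r p.1, r p.2)) ^+ 2 <= 4 by nra.
      by lra.
    (* Away from the cut blocks, a point and its representative lie in the same cell of [P] and
       agree on membership in the witness, so sampling changes nothing. *)
    move: good; rewrite !negb_or !inE !negbK => /and4P[/eqP eI /eqP eA /eqP eJ /eqP eB].
    move=> ? ? ? ?; rewrite -[leLHS]addr0; apply: lerD; last by lra.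
    rewrite /g0 /= (def_pblock trivP IP); last by rewrite -eI.
    rewrite (def_pblock trivP JP); last by rewrite -eJ.
    by rewrite !inE /= -/A -/B -eA -eB.
  apply: le_trans (ler_sum _ pt) _.
  rewrite big_split /= -mulr_sumr !big_split /=.
  have bI S : is_intvl S -> \sum_(p in setX I J) b S p.1 <= #|J|%:R * (2 * s%:R).
    move=> intS; apply: le_trans (sum_setX_fst_le _ _ _) _.
    by apply: ler_wpM2l; rewrite ?cut_le.
  have bJ S : is_intvl S -> \sum_(p in setX I J) b S p.2 <= #|I|%:R * (2 * s%:R).
    move=> intS; apply: le_trans (sum_setX_snd_le _ _ _) _.
    by apply: ler_wpM2l; rewrite ?cut_le.
  have := bI _ (intP _ IP); have := bI _ intA.
  have := bJ _ (intP _ JP); have := bJ _ intB.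
  rewrite /irregIJ => ? ? ? ?; rewrite mulrDr.
  by lra.
have cardP : \sum_(I in P) (#|I|%:R : R) = n%:R.
  by rewrite -natr_sum -(card_partition partP) cardsT card_ord.
apply: le_trans (_ : _ <= \sum_(I in P) \sum_(J in P)
  (\sum_(p in setX I J) (Y p.1 p.2 - density Y I J) ^+ 2
   - irregIJ I J * (eps ^+ 4 * (#|I|%:R * #|J|%:R))
   + 16 * s%:R * (#|I|%:R + #|J|%:R))) _.
  by apply: ler_sum => I IP; apply: ler_sum => J JP; apply: cell.
under eq_bigr => I _.
  rewrite big_split sumrB -mulr_sumr big_split /= cardP sumr_const -[_ *+ #|P|]mulr_natr.
  over.
rewrite big_split sumrB /= -mulr_sumr big_split /= -mulr_suml cardP sumr_const.
rewrite -[n%:R *+ #|P|]mulr_natr.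
have -> : 16 * s%:R * (n%:R * #|P|%:R + n%:R * #|P|%:R) = 32 * (s%:R * #|P|%:R * n%:R) :> R.
  by ring.
rewrite lerD2r lerD2l lerN2.
have k0 : 0 < (#|P|%:R : R).
  rewrite ltr0n card_gt0; apply/set0Pn; exists (pblock P (Ordinal n0)).
  by rewrite pblock_mem.
set k : R := #|P|%:R in k0 *.
have lowP I : I \in P -> n%:R / (2 * k) <= #|I|%:R :> R.
  move=> IP; rewrite ler_pdivrMr; last by rewrite mulr_gt0.
  by rewrite /k -!natrM ler_nat mulnC szP.
move: irr; rewrite /interval_regular_partition -ltNge.
have -> : (#|[set IJ in setX P P | ~~ interval_regular_pair eps Y IJ.1 IJ.2]|%:R : R)
   = \sum_(I in P) \sum_(J in P) irregIJ I J.
  rewrite -sumr_const pair_big /irregIJ.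
  rewrite big_mkcond [RHS]big_mkcond /=; apply: eq_bigr => p _.
  rewrite !inE; case: (p.1 \in P) (p.2 \in P) => -[] //=.
  by case: (interval_regular_pair _ _ _ _).
rewrite -/k => irr.
apply: le_trans (_ : _ <= \sum_(I in P) \sum_(J in P)
   irregIJ I J * (eps ^+ 4 * (n%:R / (2 * k)) ^+ 2)) _; last first.
  apply: ler_sum => I IP; apply: ler_sum => J JP.
  apply: ler_wpM2l; first by rewrite ler0n.
  apply: ler_wpM2l; first by rewrite exprn_ge0 // ltW.
  by rewrite expr2; apply: ler_pM; rewrite ?lowP // divr_ge0 // mulr_ge0 // ltW.
under [leRHS]eq_bigr do rewrite -mulr_suml.
rewrite -mulr_suml.
have -> : eps ^+ 5 / 4 * n%:R ^+ 2 = eps * k ^+ 2 * (eps ^+ 4 * (n%:R / (2 * k)) ^+ 2).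
  by field; rewrite gt_eqF.
apply: ler_wpM2r; last exact: ltW.
by rewrite mulr_ge0 ?exprn_ge0 // ?divr_ge0 // ?mulr_ge0 // ltW.
Qed.

End Energy.

(** * Large [eps]: every interval partition is regular *)

(** Both [Y] and [1 - Y] are nonnegative, so their sums grow with the rectangle. *)
Lemma sum_density_le (R : realType) n (Y : 'M[R]_n) (I J A B : {set 'I_n}) :
    unit_valued Y -> A \subset I -> B \subset J ->
  #|setX A B|%:R * density Y A B <= #|setX I J|%:R * density Y I J /\
  #|setX A B|%:R * (1 - density Y A B) <= #|setX I J|%:R * (1 - density Y I J).
Proof.
move=> Y01 AI BJ.
have sub (F : 'I_n * 'I_n -> R) : (forall p, 0 <= F p) ->
    \sum_(p in setX A B) F p <= \sum_(p in setX I J) F p.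
  move=> F0; rewrite big_mkcond [leRHS]big_mkcond; apply: ler_sum => p _.
  case: ifP => [/(subsetP (setXS AI BJ)) -> //|_].
  by case: ifP.
split.
  by rewrite -!sum_density; apply: sub => p; case/andP: (Y01 p.1 p.2).
rewrite !mulrBr !mulr1 -!sum_density -!sumr_const -!sumrB.
by apply: sub => p; rewrite subr_ge0; case/andP: (Y01 p.1 p.2).
Qed.

(* Here [1 - eps ^+ 2 <= eps], and a rectangle covering a proportion [eps ^+ 2]
   of [I x J] has density within [1 - eps ^+ 2] of that of [I x J]. *)
Lemma interval_regular_pair_large_eps (R : realType) n (Y : 'M[R]_n) eps
    (I J : {set 'I_n}) :
    unit_valued Y -> 7 / 10 <= eps -> I != set0 -> J != set0 ->
  interval_regular_pair eps Y I J.
Proof.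
move=> Y01 epsge I0 J0; apply/forallP => A; apply/forallP => B.
apply/implyP => /and5P[_ AI _ BJ /andP[cA cB]].
have /andP[x0 x1] := density_itv A B Y01; have /andP[y0 y1] := density_itv I J Y01.
have [le1|lt1] := leP 1 eps; first by rewrite ler_norml; apply/andP; split; lra.
have [] := sum_density_le Y01 AI BJ.
have cAB : eps ^+ 2 * #|setX I J|%:R <= #|setX A B|%:R.
  rewrite !cardsX !natrM.
  have -> : eps ^+ 2 * (#|I|%:R * #|J|%:R) = (eps * #|I|%:R) * (eps * #|J|%:R).
    by ring.
  by apply: ler_pM => //; apply: mulr_ge0 => //; lra.
have IJ0 : 0 < (#|setX I J|%:R : R).
  by rewrite ltr0n cardsX muln_gt0 !card_gt0 I0 J0.
move: (density Y A B) (density Y I J) x0 x1 y0 y1 => x y x0 x1 y0 y1.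
move: (#|setX A B|%:R) (#|setX I J|%:R) cAB IJ0 => N M cAB IJ0 h1 h2.
have scale z t : 0 <= z -> N * z <= M * t -> eps ^+ 2 * z <= t.
  move=> z0 h; rewrite -(ler_pM2l IJ0) mulrCA mulrA.
  by apply: le_trans h; apply: ler_wpM2r.
have := scale _ _ x0 h1; have := scale (1 - x) _ _ h2.
rewrite subr_ge0 => /(_ x1) s2 s1.
have e2 : 1 - eps ^+ 2 <= eps by nra.
have e3 : 0 <= 1 - eps ^+ 2 by nra.
rewrite ler_norml; apply/andP; split.
  have : (1 - eps ^+ 2) * (1 - x) <= 1 - eps ^+ 2 by rewrite ler_piMr //; lra.
  by lra.
have : (1 - eps ^+ 2) * x <= 1 - eps ^+ 2 by rewrite ler_piMr.
by lra.
Qed.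

Lemma interval_regular_partition_large_eps (R : realType) n (Y : 'M[R]_n) eps
    (P : {set {set 'I_n}}) :
    unit_valued Y -> 7 / 10 <= eps -> interval_partition P ->
  interval_regular_partition eps Y P.
Proof.
move=> Y01 epsge /andP[partP _].
have Pn0 : set0 \notin P by case/and3P: partP.
have ne0 U : U \in P -> U != set0 by move=> UP; apply: contraNneq Pn0 => <-.
rewrite /interval_regular_partition.
set S := [set _ in _ | _]; suff -> : S = set0.
  by rewrite cards0 mulr_ge0 ?exprn_ge0 //; lra.
apply/setP => -[I J]; rewrite !inE /=; apply: contraTF isT.
by case/andP=> /andP[/ne0 I0 /ne0 J0]; rewrite interval_regular_pair_large_eps.
Qed.

(** * Iteration over the sizes [m L ^ i] *)

Lemma exists_regular_level (R : realType) n (Y : 'M[R]_n) eps (m L T : nat) :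
    unit_valued Y -> 0 < eps <= 1 -> (0 < m)%N ->
    512 <= L%:R * eps ^+ 5 -> 8 < T%:R * eps ^+ 5 ->
  exists2 i : nat, (i <= T)%N & forall P : {set {set 'I_n}},
    interval_partition P -> equitable P -> #|P| = (m * L ^ i)%N ->
    interval_regular_partition eps Y P.
Proof.
move=> Y01 epsI m0 hL hT.
have [eps0 eps1] := andP epsI; have e5 : 0 < eps ^+ 5 by rewrite exprn_gt0.
have L0 : (0 < L)%N by case: L hL => //; rewrite mul0r; lra.
have [/existsP[i /forallP h]|] := boolP [exists i : 'I_T.+1,
    [forall P : {set {set 'I_n}}, [&& interval_partition P, equitable P &
       #|P| == (m * L ^ i)%N] ==> interval_regular_partition eps Y P]].
  exists i => [|P ip eq cP]; first by rewrite -ltnS.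
  by have := h P; rewrite ip eq cP eqxx.
rewrite negb_exists => /forallP bad.
have {}bad i : (i <= T)%N -> exists P : {set {set 'I_n}},
    [/\ interval_partition P, equitable P, #|P| = (m * L ^ i)%N &
        ~~ interval_regular_partition eps Y P].
  rewrite -ltnS => iT; have /forallPn[P] := bad (Ordinal iT).
  by rewrite negb_imply => /andP[/and3P[? ? /eqP ?] ?]; exists P.
(* For [n = 0] the only partition is empty, but the bad one of level 0 has [m > 0] parts. *)
have n0 : (0 < n)%N.
  have [P [/andP[partP _] _ cP _]] := bad 0%N isT.
  rewrite -[n]card_ord -cardsT card_gt0; apply: contraTneq partP => ->.
  apply: contraTN m0 => partP; rewrite -leqNgt -[m]muln1 -[1%N](expn0 L) -cP.
  by rewrite leqn0 cards_eq0 -partition_set0.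
have nR0 : 0 < (n%:R : R) by rewrite ltr0n.
have decay i : (i <= T)%N -> exists P : {set {set 'I_n}},
    [/\ interval_partition P, equitable P, #|P| = (m * L ^ i)%N,
        ~~ interval_regular_partition eps Y P &
        step_error Y P <= (1 - i%:R * (eps ^+ 5 / 8)) * n%:R ^+ 2].
  elim: i => [|i IH] iT.
    have [P [ip eq cP irr]] := bad 0%N isT; exists P; split=> //.
    by rewrite mul0r subr0 mul1r step_error_le_sqr //; case/andP: ip.
  have [P [ipP eqP cP irrP errP]] := IH (ltnW iT).
  have [Q [ipQ eqQ cQ irrQ]] := bad i.+1 iT; exists Q; split=> //.
  have Q0 : (0 < #|Q|)%N by rewrite cQ muln_gt0 m0 expn_gt0 L0.
  pose s := (2 * n %/ #|Q|)%N.
  have szQ U : U \in Q -> (#|U| <= s)%N.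
    by move=> UQ; rewrite /s leq_divRL // mulnC equitable_card_le.
  have szP U : U \in P -> (n <= 2 * #|P| * #|U|)%N.
    exact: equitable_card_ge.
  apply: le_trans (step_error_decrement Y01 epsI n0 ipP ipQ szP szQ irrP) _.
  (* Only the sizes of [P] and [Q] are compared: [#|Q| = #|P| L]. *)
  have sk : s%:R * #|P|%:R * L%:R <= 2 * n%:R :> R.
    by rewrite -!natrM ler_nat -mulnA cP -mulnA -expnSr -cQ leq_divM.
  set t : R := s%:R * #|P|%:R * n%:R.
  have tL : t * L%:R <= 2 * n%:R ^+ 2.
    have -> : t * L%:R = s%:R * #|P|%:R * L%:R * n%:R by rewrite /t; ring.
    by rewrite expr2 mulrA ler_pM2r.
  have t0 : 0 <= t by rewrite /t !mulr_ge0.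
  (* So [512 t <= 2 n ^ 2 eps ^ 5], and the sampling cost [32 t] is at most [eps ^ 5 n ^ 2 / 8],
     half of the gain. *)
  have : t * 512 <= t * (L%:R * eps ^+ 5) by apply: ler_wpM2l.
  have : t * L%:R * eps ^+ 5 <= 2 * n%:R ^+ 2 * eps ^+ 5 by rewrite ler_pM2r.
  by rewrite -natr1; lra.
have [P [_ _ _ _ err]] := decay T (leqnn T).
have : 0 <= (1 - T%:R * (eps ^+ 5 / 8)) * n%:R ^+ 2.
  exact: le_trans (step_error_ge0 Y P) err.
rewrite pmulr_lge0 ?exprn_gt0 //; lra.
Qed.

(** * Comparison of the sizes with the bound [M] *)

(** With [u = 1 / eps] one has [u ^ 2 >= 2], so [L <= 513 u ^ 5 <= u ^ 25] as [u ^ 20 >= 1024]. Also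
    [T <= 9 u ^ 5], whence the exponent [225 = 25 * 9]. *)
Lemma level_size_bound (R : realType) (eps : R) (m L T i : nat) :
    0 < eps <= 7 / 10 -> (0 < m)%N -> (i <= T)%N -> (0 < L)%N ->
    L%:R <= 512 * eps ^- 5 + 1 -> T%:R <= 8 * eps ^- 5 + 1 ->
  (m * L ^ i)%:R <= m%:R `^ 225 * eps `^ (- (225 * eps ^- 5)).
Proof.
move=> /andP[eps0 eps1] m0 iT L0 hL hT.
have u1 : 2 <= eps^-1 ^+ 2.
  rewrite exprVn -[leLHS]invrK lef_pV2 ?posrE ?invr_gt0 ?exprn_gt0 //.
  by nra.
rewrite -exprVn in hL hT *; set u := eps^-1 in u1 hL hT *.
have u0 : 0 < u by rewrite invr_gt0.
have u1' : 1 <= u by nra.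
have v1 : 1 <= u ^+ 5 by rewrite exprn_ege1.
have Lu : L%:R <= u ^+ 25.
  have : 1024 <= u ^+ 20.
    have -> : u ^+ 20 = (u ^+ 2) ^+ 10 by rewrite -exprM.
    have -> : (1024 : R) = 2 ^+ 10 by ring.
    by apply: lerXn2r; rewrite ?nnegrE ?exprn_ge0 ?ler0n ?(ltW u0).
  have -> : u ^+ 25 = u ^+ 20 * u ^+ 5 by rewrite -exprD.
  by nra.
rewrite natrM natrX; apply: ler_pM => //.
- by rewrite exprn_ge0.
- by apply: le1r_powR; rewrite ?ler1n //; lra.
apply: le_trans (_ : _ <= (u ^+ 25) ^+ T) _.
  apply: le_trans (_ : _ <= L%:R ^+ T) _.
    by apply: ler_weXn2l; rewrite ?ler1n.
  by apply: lerXn2r; rewrite ?nnegrE ?exprn_ge0 ?ler0n ?(ltW u0).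
rewrite -exprM /u exprVn -powR_invn; last exact: ltW.
apply: ger_powR; first by rewrite eps0; lra.
by rewrite lerN2 natrM -/u; lra.
Qed.

(** This admits [k = m]. When [eps > 1] the power of [eps] is below 1, but its logarithm is at least
    [- 225 / 4], while [224 ln m >= 112] for [m >= 2]. *)
Lemma size_bound_large_eps (R : realType) (eps : R) (m : nat) :
    0 < eps -> (0 < m)%N -> eps <= 1 \/ (1 < m)%N ->
  m%:R <= m%:R `^ 225 * eps `^ (- (225 * eps ^- 5)).
Proof.
move=> eps0 m0 hyp; have mR : 0 < (m%:R : R) by rewrite ltr0n.
have v0 : 0 <= eps ^- 5 by rewrite invr_ge0 exprn_ge0 // ltW.
have [eps1|eps1] := leP eps 1.
  have p1 : 1 <= eps `^ (- (225 * eps ^- 5)).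
    rewrite -[leLHS](powRr0 eps); apply: ger_powR; first by rewrite eps0.
    by rewrite oppr_le0 mulr_ge0.
  apply: le_trans (_ : _ <= m%:R `^ 225) _.
    by apply: le1r_powR; rewrite ?ler1n //; lra.
  by rewrite ler_peMr // powR_ge0.
have {hyp} m1 : (1 < m)%N by case: hyp => // /(lt_le_trans eps1); rewrite ltxx.
have ln2 : 2^-1 <= ln 2 :> R.
  have := @le_ln1Dx R (2^-1 - 1); rewrite [1 + _]addrC subrK => h.
  have : ln (2^-1 : R) <= 2^-1 - 1 by apply: h; lra.
  by rewrite lnV ?posrE //; lra.
have lnm : ln 2 <= ln m%:R :> R by rewrite ler_ln ?posrE // ler_nat.
have lneps : eps ^- 5 * ln eps <= 4^-1.
  have le1 : ln eps <= eps - 1.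
    by have := @le_ln1Dx R (eps - 1); rewrite [1 + _]addrC subrK; apply; lra.
  rewrite mulrC ler_pdivrMr ?exprn_gt0 //; apply: le_trans le1 _.
  have : eps ^+ 2 <= eps ^+ 5 by apply: ler_weXn2l => //; apply: ltW.
  (* The square gives [eps - 1 <= eps ^ 2 / 4]. *)
  by have := sqr_ge0 (eps - 2); lra.
rewrite /powR !gt_eqF // -expRD -[leLHS]lnK ?posrE // ler_expR.
by lra.
Qed.

(** * Permutation matrices and the choice of [L] and [T] *)

Lemma perm_matrix_lt_unit_valued (R : realType) n (sigma : 'S_n) :
  unit_valued (perm_matrix_lt R sigma).
Proof. by move=> i j; rewrite mxE; case: (_ < _)%N; rewrite ?ler01 ?lexx. Qed.

Theorem theorem7p5 (R : realType) :
  exists C : R, 0 < C /\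
    forall (eps : R) (m : nat), 0 < eps -> (0 < m)%N ->
    (* for m = 1 and eps > 1 one has M < 1 = m, so no k exists *)
    eps <= 1 \/ (1 < m)%N ->
    let M : R := m%:R `^ C * eps `^ (- (C * eps ^- 5)) in
    forall (n : nat) (sigma : 'S_n),
    exists k : nat,
      [/\ (m <= k)%N, k%:R <= M &
          forall P : {set {set 'I_n}},
            interval_partition P -> equitable P -> #|P| = k ->
            perm_regular_partition eps sigma P].
Proof.
exists 225; split=> // eps m eps0 m0 hyp M n sigma.
have Y01 := @perm_matrix_lt_unit_valued R n sigma.
(* The threshold lies between [(sqrt 5 - 1) / 2], above which [1 - eps ^ 2 <= eps], and
   [1 / sqrt 2], below which [eps ^ -2 >= 2]. *)
have [epsge|epslt] := leP (7 / 10) eps.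
  exists m; split=> //; first exact: size_bound_large_eps.
  by move=> P ip _ _; apply: interval_regular_partition_large_eps.
have e5 : 0 < eps ^+ 5 by rewrite exprn_gt0.
have v0 : 0 <= eps ^- 5 by rewrite invr_ge0 ltW.
have [L [L0 L1 L2]] : exists L : nat,
    [/\ (0 < L)%N, 512 * eps ^- 5 < L%:R & L%:R <= 512 * eps ^- 5 + 1].
  have /andP[h1 h2] := truncn_itv (mulr_ge0 (ler0n R 512) v0).
  by exists (Num.truncn (512 * eps ^- 5)).+1; split=> //; rewrite -natr1 lerD2r.
have [T [T1 T2]] : exists T : nat,
    8 * eps ^- 5 < T%:R /\ T%:R <= 8 * eps ^- 5 + 1.
  have /andP[h1 h2] := truncn_itv (mulr_ge0 (ler0n R 8) v0).
  by exists (Num.truncn (8 * eps ^- 5)).+1; split=> //; rewrite -natr1 lerD2r.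
rewrite ltr_pdivrMr // in L1; rewrite ltr_pdivrMr // in T1.
have [|i iT reg] := exists_regular_level Y01 _ m0 (ltW L1) T1.
  by rewrite eps0; lra.
exists (m * L ^ i)%N; split=> //.
- by rewrite leq_pmulr // expn_gt0 L0.
- by apply: level_size_bound iT _ _ _; rewrite ?eps0 ?(ltW epslt).
Qed.
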